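(* Let $X$ be a $k$-regular connected graph and $S\subseteq V$ a nonempty set of marked vertices. Let $\lambda_r$ and $G_r$ be the $r$-th (distinct) eigenvalue and eigenprojection of $A_{\overline{S}}$. Then $\widehat{M}=\widehat{M}_1+\widehat{M}_{-1}+\sum_r\widehat{M}_r$, where, in block form with rows and columns indexed by $S$ then $\overline{S}$, $$\widehat{M}_1=\frac{1}{4k}\begin{pmatrix}Q_S+H(L_{\overline{S}}^{-1}H^T)^{\circ2}-2I\circ(HL_{\overline{S}}^{-1}H^T)&0\\ H^T-L_{\overline{S}}(L_{\overline{S}}^{-1}H^T)^{\circ2}&0\end{pmatrix},$$ $$\widehat{M}_{-1}=\frac{1}{4k}\begin{pmatrix}Q_S+H(Q_{\overline{S}}^{-1}H^T)^{\circ2}-2I\circ(HQ_{\overline{S}}^{-1}H^T)&0\\ H^T-L_{\overline{S}}(Q_{\overline{S}}^{-1}H^T)^{\circ2}&0\end{pmatrix},$$ $$\widehat{M}_r=\frac{1}{2(k^2-\lambda_r^2)}\begin{pmatrix}kH\\ (k^2-2\lambda_r^2)I+kA_{\overline{S}}\end{pmatrix}\begin{pmatrix}\frac{1}{k^2-\lambda_r^2}(G_rH^T)^{\circ2} & G_r^{\circ2}\end{pmatrix}.$$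
   Context: Arcs are ordered pairs $(u,v)$ of adjacent vertices ($u$ tail); $R$ is the arc-reversal permutation matrix; $D_t$ is the $V\times\text{arcs}$ tail incidence matrix ($(D_t)_{x,(u,v)}=1$ iff $x=u$); $O_S$ is the identity with $[S,S]$ block zeroed; the transition matrix is $U=R\left(\frac2kD_t^TO_SD_t-I\right)$, with spectral decomposition $U=\sum_\theta e^{i\theta}F_\theta$. The average vertex mixing matrix $\widehat{M}$ is the $n\times n$ matrix with $\widehat{M}_{u,v}=\lim_{T\to\infty}\frac1T\sum_{t=0}^{T-1}\sum_{w\sim u}\left|(U^tx_v)_{(u,w)}\right|^2$ where $x_v=k^{-1/2}D_t^Te_v$; equivalently $\widehat{M}_{u,v}=\frac1k e_u^TD_t\sum_\theta (F_\theta D_t^Te_v)\circ\overline{(F_\theta D_t^Te_v)}$. With $\overline S=V\setminus S$, write $A=\begin{pmatrix}A_S&H\\H^T&A_{\overline S}\end{pmatrix}$, $L=kI-A$, $Q=kI+A$, $Q_S=Q[S,S]$, $L_{\overline S}=L[\overline S,\overline S]$, $Q_{\overline S}=Q[\overline S,\overline S]$. $\circ$ denotes the entrywise (Schur) product and $N^{\circ2}=N\circ N$. *)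

(* Defs.v *)
From HB Require Import structures.
From mathcomp Require Import all_boot all_order all_algebra.
From mathcomp Require Import all_classical all_reals all_analysis.

Set Implicit Arguments.
Unset Strict Implicit.
Unset Printing Implicit Defensive.

Import Order.TTheory GRing.Theory Num.Theory.
Import numFieldNormedType.Exports.

Local Open Scope classical_set_scope.
Local Open Scope ring_scope.

Definition simple_graph (V : finType) (e : rel V) : Prop :=
  symmetric e /\ irreflexive e.

Definition regular_graph (V : finType) (e : rel V) (k : nat) : Prop :=
  forall u : V, #|[set v | e u v]%SET| = k.

Definition connected_graph (V : finType) (e : rel V) : Prop :=
  forall u v : V, connect e u v.

(* [eigenspace A a] is a space of row vectors; since P is symmetric, its row
   and column spaces agree, so for a symmetric matrix A the third condition
   also identifies the column space of P with the usual eigenspace. *)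
Definition eigenprojection (R : realType) (n : nat) (A : 'M[R]_n) (a : R)
    (P : 'M[R]_n) : Prop :=
  [/\ P *m P = P, P^T = P & (P :=: eigenspace A a)%MS].

Definition distinct_eigenvalues (R : realType) (n : nat) (A : 'M[R]_n)
    (m : nat) (lambda : 'I_m -> R) : Prop :=
  injective lambda /\ (forall a : R, eigenvalue A a <-> exists r, lambda r = a).

Definition schur (R : realType) (m n : nat) (A B : 'M[R]_(m, n)) :
  'M[R]_(m, n) := map2_mx *%R A B.

Definition schur_sq (R : realType) (m n : nat) (A : 'M[R]_(m, n)) :
  'M[R]_(m, n) := schur A A.

Section QuantumWalk.
Variables (R : realType) (V : finType) (e : rel V) (k : nat) (S : {set V}).

Local Notation s := #|S|.
Local Notation t := #|~: S|.

(* Vertex-indexed matrices use the ordering of V that lists S first and then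
   its complement, so that ulsubmx, ursubmx, dlsubmx and drsubmx are the blocks
   [S,S], [S,~:S], [~:S,S] and [~:S,~:S]. *)
Definition vtx (i : 'I_(s + t)) : V :=
  match fintype.split i with
  | inl i1 => enum_val i1
  | inr i2 => enum_val i2
  end.

Definition arcs : {set V * V} := [set a | e a.1 a.2]%SET.
Definition arc_of (a : 'I_#|arcs|) : V * V := enum_val a.

Definition arc_rev : 'M[R]_#|arcs| :=
  \matrix_(a, b) (arc_of a == ((arc_of b).2, (arc_of b).1))%:R.

Definition tail_inc : 'M[R]_(s + t, #|arcs|) :=
  \matrix_(x, a) (vtx x == (arc_of a).1)%:R.

Definition O_S : 'M[R]_(s + t) := block_mx 0 0 0 1%:M.

Definition transition : 'M[R]_#|arcs| :=
  arc_rev *m ((2 / k%:R) *: (tail_inc^T *m O_S *m tail_inc) - 1%:M).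

Definition init_state (v : 'I_(s + t)) : 'cV[R]_#|arcs| :=
  (Num.sqrt k%:R)^-1 *: (tail_inc^T *m delta_mx v 0).

(* The arcs (u, w) with w adjacent to u are exactly the arcs with tail u. *)
Definition vertex_prob (u v : 'I_(s + t)) (n : nat) : R :=
  \sum_(a : 'I_#|arcs| | (arc_of a).1 == vtx u)
    `| (transition ^+ n *m init_state v) a 0 | ^+ 2.

Definition time_avg (u v : 'I_(s + t)) (T : nat) : R :=
  T%:R^-1 * \sum_(n < T) vertex_prob u v n.

Definition avg_mixing : 'M[R]_(s + t) :=
  \matrix_(u, v) lim (time_avg u v T @[T --> \oo]).

Definition adj : 'M[R]_(s + t) := \matrix_(i, j) (e (vtx i) (vtx j))%:R.

Definition laplacian : 'M[R]_(s + t) := k%:R%:M - adj.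
Definition signless_laplacian : 'M[R]_(s + t) := k%:R%:M + adj.

Definition adj_H : 'M[R]_(s, t) := ursubmx adj.
Definition A_Sbar : 'M[R]_t := drsubmx adj.
Definition L_Sbar : 'M[R]_t := drsubmx laplacian.
Definition Q_Sbar : 'M[R]_t := drsubmx signless_laplacian.
Definition Q_S : 'M[R]_s := ulsubmx signless_laplacian.

Definition M_pos1 : 'M[R]_(s + t) :=
  (4 * k%:R)^-1 *: block_mx
    (Q_S + adj_H *m schur_sq (invmx L_Sbar *m adj_H^T)
       - 2 *: schur 1%:M (adj_H *m invmx L_Sbar *m adj_H^T)) 0
    (adj_H^T - L_Sbar *m schur_sq (invmx L_Sbar *m adj_H^T)) 0.

(* The lower left block really pairs L_Sbar with the inverse of Q_Sbar: the
   decomposition fails if Q_Sbar replaces L_Sbar there. *)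
Definition M_neg1 : 'M[R]_(s + t) :=
  (4 * k%:R)^-1 *: block_mx
    (Q_S + adj_H *m schur_sq (invmx Q_Sbar *m adj_H^T)
       - 2 *: schur 1%:M (adj_H *m invmx Q_Sbar *m adj_H^T)) 0
    (adj_H^T - L_Sbar *m schur_sq (invmx Q_Sbar *m adj_H^T)) 0.

Definition M_eig (lambda : R) (G : 'M[R]_t) : 'M[R]_(s + t) :=
  (2 * (k%:R ^+ 2 - lambda ^+ 2))^-1 *:
    (col_mx (k%:R *: adj_H)
            ((k%:R ^+ 2 - 2 * lambda ^+ 2)%:M + k%:R *: A_Sbar)
     *m row_mx ((k%:R ^+ 2 - lambda ^+ 2)^-1 *: schur_sq (G *m adj_H^T))
               (schur_sq G)).

End QuantumWalk.

(* Main.v *)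
(* Put [p = col_mx 0 g] with [g] an eigenvector of [A_Sbar] for [lambda].  The
   walk leaves the plane spanned by [D^T p] and [R D^T p] invariant and acts on
   it by [U ^ 2 = 2 c U - 1] with [c = lambda / k], where [|lambda| < k] by the
   maximum principle.  On the orthogonal complement of all these planes
   [O_S D] and [O_S D R] vanish, so [U = - R] there, and the eigenvalues are
   [1] and [-1].  An initial state splits accordingly into an explicit sum of
   vectors [Z] with [U Z = Z] or [U Z = - Z] and vectors [Y] with
   [U ^ 2 Y = 2 c U Y - Y].

   Hence every coordinate of the orbit is a sum of bounded real sequences
   [f (n+2) = 2 c f (n+1) - f n] with distinct [c].  No complex eigenvector is
   needed to average its square: up to telescoping terms, products of two such
   sequences with different [c] average to zero (discrete Wronskian), and
   [f n ^ 2] averages to a multiple of the conserved quantity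
   [f n ^ 2 + f (n+1) ^ 2 - 2 c f n f (n+1)].  Adding the means over the arcs
   leaving a vertex turns them into the blocks of the stated matrices. *)

Require Import Defs.
From mathcomp Require Import all_boot all_order all_algebra.
From mathcomp Require Import complex.
From mathcomp Require Import all_classical all_reals all_analysis.
From mathcomp Require Import ring lra.

Set Implicit Arguments.
Unset Strict Implicit.
Unset Printing Implicit Defensive.

Import Order.TTheory GRing.Theory Num.Theory.
Import numFieldNormedType.Exports.

Local Open Scope classical_set_scope.
Local Open Scope ring_scope.

(** * Spectral resolution of a symmetric matrix *)

Lemma eigenprojection_mulr (R : realType) n (A : 'M[R]_n) a P :
  eigenprojection A a P -> P *m A = a *: P.
Proof. by case=> _ _ PE; apply/eigenspaceP; rewrite -PE. Qed.

Lemma eigenprojection_mull (R : realType) n (A : 'M[R]_n) a P :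
  A^T = A -> eigenprojection A a P -> A *m P = a *: P.
Proof.
move=> AT /[dup] /eigenprojection_mulr PA [_ PT _].
by apply: trmx_inj; rewrite trmx_mul AT PT PA linearZ /= PT.
Qed.

Lemma eigenprojection_ortho (R : realType) n (A : 'M[R]_n) a b P Q :
  A^T = A -> eigenprojection A a P -> eigenprojection A b Q -> a != b ->
  P *m Q = 0.
Proof.
move=> AT /eigenprojection_mulr PA /(eigenprojection_mull AT) AQ ab.
have /eqP : (a - b) *: (P *m Q) = 0.
  by rewrite scalerBl scalemxAl -PA -mulmxA AQ -scalemxAr subrr.
by rewrite scaler_eq0 subr_eq0 (negPf ab) => /eqP.
Qed.

Lemma eigenvalue_map (F L : fieldType) (f : {rmorphism F -> L}) n
    (A : 'M[F]_n) a : eigenvalue (map_mx f A) (f a) = eigenvalue A a.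
Proof. by rewrite !eigenvalue_root_char -map_char_poly fmorph_root. Qed.

Lemma map_eigenspace (F L : fieldType) (f : {rmorphism F -> L}) n
    (A : 'M[F]_n) a :
  map_mx f (eigenspace A a) = eigenspace (map_mx f A) (f a).
Proof. by rewrite /eigenspace map_kermx map_mxB map_scalar_mx. Qed.

(** Over the complex numbers the matrix is hermitian, so it is diagonalised by a unitary matrix with
    real eigenvalues. Each row of that matrix lies in the complexified row space of one [G r], hence
    is fixed by the sum, and the rows together are invertible. *)
Lemma eigenprojection_sum1 (R : realType) n m (A : 'M[R]_n)
    (lambda : 'I_m -> R) (G : 'I_m -> 'M[R]_n) :
  A^T = A -> distinct_eigenvalues A lambda ->
  (forall r, eigenprojection A (lambda r) (G r)) ->
  \sum_(r < m) G r = 1%:M.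
Proof.
move=> AT [lambda_inj lambdaP] GP.
pose f : {rmorphism R -> R[i]%C} := real_complex R.
pose B := map_mx f A.
have Breal : B \is a mxOver Num.real.
  by apply/mxOverP => i j; rewrite mxE; apply/complex_realP; exists (A i j).
have Bherm : B \is hermsymmx.
  apply: realsym_hermsym => //; apply/is_hermitianmxP.
  by rewrite expr0 scale1r map_mx_id // map_trmx AT.
have /orthomx_spectralP BE := hermitian_normalmx Bherm.
have dreal := hermitian_spectral_diag_real Bherm.
have Pu := spectral_unit B.
set P := spectralmx B in BE Pu; set d := spectral_diag B in BE dreal.
have PB : P *m B = diag_mx d *m P by rewrite BE !mulmxA mulmxV ?mul1mx.
suff PG : P *m (map_mx f (\sum_r G r)) = P.
  apply: (map_mx_inj (f := f)); rewrite map_mx1.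
  by rewrite -[LHS](mulKmx Pu) PG mulVmx.
apply/row_matrixP => j; rewrite row_mul.
have vB : row j P *m B = d 0 j *: row j P.
  by rewrite -row_mul PB row_mul row_diag_mx -scalemxAl -rowE.
have v0 : row j P != 0.
  apply/eqP => v0; have := congr1 (row j) (mulmxV Pu).
  rewrite row_mul v0 mul0mx => /rowP/(_ j); rewrite !mxE eqxx => /eqP.
  by rewrite eq_sym oner_eq0.
have /mxOverP/(_ 0 j)/complex_realP[x dx] := dreal.
have /lambdaP[r lr] : eigenvalue A x.
  rewrite -(eigenvalue_map f); apply/eigenvalueP; exists (row j P) => //.
  by rewrite vB dx.
(* Kernels commute with field extension, so the complex eigenspace of a real eigenvalue is spanned
   by the real one. *)
have /submxP[w wP] : (row j P <= map_mx f (G r))%MS.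
  have /eigenspaceP : row j P *m B = f (lambda r) *: row j P.
    by rewrite vB dx lr.
  move/submx_trans; apply; rewrite -map_eigenspace map_submx.
  by have [_ _ ->] := GP r.
rewrite raddf_sum mulmx_sumr (bigD1 r) //= [X in _ + X]big1 => [|i ir].
  by rewrite addr0 wP -mulmxA -map_mxM; have [-> _ _] := GP r.
rewrite wP -mulmxA -map_mxM (eigenprojection_ortho AT (GP r) (GP i)).
  by rewrite map_mx0 mulmx0.
by apply: contra ir => /eqP/lambda_inj ->.
Qed.

(** * Time averages of second-order recurrences *)

(** Stronger than convergence of the time averages: the error is O(1/T). This form is closed under
    finite sums and comes directly from telescoping, so limits are taken only at the very end. *)
Definition bounded_discrepancy (R : realType) (f : nat -> R) (l : R) :=
  exists C : R, forall T, `|\sum_(n < T) (f n - l)| <= C.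

Lemma bounded_discrepancy_cvg (R : realType) (f : nat -> R) l :
  bounded_discrepancy f l ->
  T%:R^-1 * \sum_(n < T) f n @[T --> \oo] --> l.
Proof.
case=> C fC; apply/cvgrPdist_le => eps eps0; near=> T.
have T0 : 0 < T%:R :> R by rewrite ltr0n; near: T; exists 1%N.
have -> : l - T%:R^-1 * \sum_(n < T) f n = - (T%:R^-1 * \sum_(n < T) (f n - l)).
  rewrite sumrB sumr_const card_ord -[l *+ T]mulr_natl mulrBr mulrA.
  by rewrite mulVf ?lt0r_neq0 // mul1r opprB.
rewrite normrN normrM normfV [`|T%:R|]ger0_norm ?ler0n // mulrC.
rewrite ler_pdivrMr //; apply: le_trans (fC T) _.
rewrite mulrC -ler_pdivrMr //; near: T.
exact: nbhs_infty_ger.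
Unshelve. all: by end_near. Qed.

Lemma bounded_discrepancy_telescope (R : realType) (f g : nat -> R) l C :
  (forall n, f n - l = g n.+1 - g n) -> (forall n, `|g n| <= C) ->
  bounded_discrepancy f l.
Proof.
move=> fg gC; exists (C + C) => T; under eq_bigr do rewrite fg.
rewrite -(big_mkord xpredT (fun n => g n.+1 - g n)) telescope_sumr //.
exact: le_trans (ler_normB _ _) (lerD _ _).
Qed.

Lemma bounded_discrepancy_sum (R : realType) (I : finType) (P : pred I)
    (f : I -> nat -> R) (l : I -> R) :
  (forall i, bounded_discrepancy (f i) (l i)) ->
  bounded_discrepancy (fun n => \sum_(i | P i) f i n) (\sum_(i | P i) l i).
Proof.
move=> /choice[C fC]; exists (\sum_(i | P i) C i) => T.
under eq_bigr do rewrite -sumrB.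
rewrite exchange_big; apply: le_trans (ler_norm_sum _ _ _) _.
by apply: ler_sum => i _; exact: fC.
Qed.

(** For [c = cos x] with [|c| < 1] the solutions are the combinations of [cos (n x)] and
    [sin (n x)]. Constant sequences solve it for [c = 1], alternating ones for [c = -1]. *)
Definition chebyshev_rec (R : realType) (c : R) (f : nat -> R) :=
  forall n, f n.+2 = 2 * c * f n.+1 - f n.

(** The conserved [E n] is the sum of [(f n.+1 - c * f n) ^+ 2] and [(1 - c ^+ 2) * f n ^+ 2], hence
    bounds the latter. Using [|x| <= 1 + x ^+ 2] avoids a square root. *)
Lemma chebyshev_rec_bounded (R : realType) (c : R) f :
  c ^+ 2 < 1 -> chebyshev_rec c f -> exists C, forall n, `|f n| <= C.
Proof.
move=> c1 fc; pose E n := f n ^+ 2 + f n.+1 ^+ 2 - 2 * c * f n * f n.+1.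
have EE n : E n = E 0%N.
  by elim: n => // n <-; rewrite /E fc; ring.
exists (1 + E 0%N / (1 - c ^+ 2)) => n.
have c0 : 0 < 1 - c ^+ 2 by rewrite subr_gt0.
have : `|f n| <= 1 + f n ^+ 2.
  rewrite -(real_normK (num_real (f n))).
  have := sqr_ge0 (`|f n| - 1); have := sqr_ge0 `|f n|; nra.
move/le_trans; apply; rewrite lerD2l ler_pdivlMr //.
rewrite -(EE n) /E -subr_ge0.
have -> : f n ^+ 2 + f n.+1 ^+ 2 - 2 * c * f n * f n.+1 - f n ^+ 2 * (1 - c ^+ 2)
   = (f n.+1 - c * f n) ^+ 2 by ring.
exact: sqr_ge0.
Qed.

Lemma chebyshev_rec_orthogonal (R : realType) (c d : R) f g Cf Cg :
  c != d -> chebyshev_rec c f -> chebyshev_rec d g ->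
  (forall n, `|f n| <= Cf) -> (forall n, `|g n| <= Cg) ->
  bounded_discrepancy (fun n => f n * g n) 0.
Proof.
move=> cd fc gd fC gC.
(* The discrete Wronskian [f n * g n.-1 - f n.-1 * g n], with the index [n.-1]
   eliminated through the recurrences, telescopes to [2 (c - d) f n g n]. *)
pose W n := 2 * (d - c) * f n * g n - f n * g n.+1 + f n.+1 * g n.
have cd0 : 2 * (c - d) != 0 by rewrite mulf_neq0 ?pnatr_eq0 // subr_eq0.
have Cf0 : 0 <= Cf := le_trans (normr_ge0 _) (fC 0%N).
have fgC n p : `|f n * g p| <= Cf * Cg by rewrite normrM ler_pM.
apply: (@bounded_discrepancy_telescope _ _ (fun n => (2 * (c - d))^-1 * W n) _
  (`|2 * (c - d)|^-1 * (`|2 * (d - c)| * (Cf * Cg) + Cf * Cg + Cf * Cg))).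
  move=> n; rewrite /W fc gd subr0 -mulrBr.
  by apply: (mulfI cd0); rewrite mulVKf //; ring.
move=> n; rewrite normrM normfV ler_wpM2l ?invr_ge0 // /W.
apply: le_trans (ler_normD _ _) _; rewrite lerD //.
apply: le_trans (ler_normB _ _) _; rewrite lerD // -mulrA normrM.
by rewrite ler_wpM2l.
Qed.

(* Mean of [f n ^ 2] for [f] obeying [chebyshev_rec c] with [f 0 = x] and
   [f 1 = y]. *)
Definition chebyshev_mean (R : realType) (c x y : R) : R :=
  (x ^+ 2 + y ^+ 2 - 2 * c * x * y) / (2 * (1 - c ^+ 2)).

Lemma chebyshev_rec_sqr (R : realType) (c : R) f :
  c ^+ 2 < 1 -> chebyshev_rec c f ->
  bounded_discrepancy (fun n => f n ^+ 2) (chebyshev_mean c (f 0%N) (f 1%N)).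
Proof.
move=> c1 fc; have [C fC] := chebyshev_rec_bounded c1 fc.
have C0 : 0 <= C := le_trans (normr_ge0 _) (fC 0%N).
have c0 : 1 - c ^+ 2 != 0 by rewrite lt0r_neq0 // subr_gt0.
have mE n : chebyshev_mean c (f n) (f n.+1) = chebyshev_mean c (f 0%N) (f 1%N).
  by elim: n => // n <-; rewrite /chebyshev_mean fc; congr (_ / _); ring.
(* With [x = f n] and [y = f n.+1], matching the coefficients of [x ^+ 2] and [x * y] in the
   telescoping identity determines [a] and [b]; those of [y ^+ 2] then agree. *)
pose a := (2 * (1 - c ^+ 2))^-1 - 1; pose b := - c / (2 * (1 - c ^+ 2)).
have fgC n p : `|f n * f p| <= C * C by rewrite normrM ler_pM.
apply: (@bounded_discrepancy_telescope _ _
  (fun n => a * (f n * f n) + b * (f n * f n.+1)) _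
  (`|a| * (C * C) + `|b| * (C * C))).
  by move=> n; rewrite -(mE n) fc /a /b /chebyshev_mean; field.
move=> n; apply: le_trans (ler_normD _ _) _.
by rewrite !normrM lerD // ler_wpM2l // -normrM.
Qed.

(** Once the square is expanded, the cross terms average to zero because the [c i] are distinct.
    Boundedness is assumed directly so that [c i = 1] and [c i = -1] are covered too. *)
Lemma bounded_discrepancy_sqr_sum (R : realType) (I : finType) (c : I -> R)
    (f : I -> nat -> R) (l C : I -> R) :
  injective c -> (forall i, chebyshev_rec (c i) (f i)) ->
  (forall i n, `|f i n| <= C i) ->
  (forall i, bounded_discrepancy (fun n => f i n ^+ 2) (l i)) ->
  bounded_discrepancy (fun n => (\sum_i f i n) ^+ 2) (\sum_i l i).
Proof.
move=> c_inj fc fC fl.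
have -> : \sum_i l i = \sum_i \sum_j (if j == i then l i else 0).
  by apply: eq_bigr => i _; rewrite -big_mkcond big_pred1_eq.
have -> : (fun n => (\sum_i f i n) ^+ 2) =
    (fun n => \sum_i \sum_j f i n * f j n).
  apply/funext => n; rewrite expr2 mulr_suml; apply: eq_bigr => i _.
  by rewrite mulr_sumr.
apply: bounded_discrepancy_sum => i; apply: bounded_discrepancy_sum => j.
case: eqVneq => [->|ij]; first exact: fl.
apply: chebyshev_rec_orthogonal (fc i) (fc j) (fC i) (fC j).
by apply: contra ij => /eqP/c_inj ->.
Qed.

(** The eigenvectors [Z b] fit the same recurrence with parameter [(-1) ^+ b], which differs from
    every [c r] since [c r ^+ 2 < 1]. All components of the orbit are thus treated as one family
    indexed by [bool + 'I_m]. *)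
Lemma matrix_orbit_discrepancy (R : realType) (N m : nat) (U : 'M[R]_N)
    (x : 'cV[R]_N) (Z : bool -> 'cV[R]_N) (Y : 'I_m -> 'cV[R]_N)
    (c : 'I_m -> R) (a : 'I_N) :
  injective c -> (forall r, c r ^+ 2 < 1) ->
  (forall b, U *m Z b = (-1) ^+ b *: Z b) ->
  (forall r, U *m (U *m Y r) = (2 * c r) *: (U *m Y r) - Y r) ->
  x = \sum_b Z b + \sum_r Y r ->
  bounded_discrepancy (fun n => ((U ^+ n *m x) a 0) ^+ 2)
    (\sum_b (Z b a 0) ^+ 2 +
     \sum_r chebyshev_mean (c r) (Y r a 0) ((U *m Y r) a 0)).
Proof.
move=> c_inj c1 UZ UY ->.
pose y (i : bool + 'I_m) := match i with inl b => Z b | inr r => Y r end.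
pose d (i : bool + 'I_m) : R :=
  match i with inl b => (-1) ^+ b | inr r => c r end.
pose f i n := (U ^+ n *m y i) a 0.
pose l i : R := match i with
  | inl b => (Z b a 0) ^+ 2
  | inr r => chebyshev_mean (c r) (Y r a 0) ((U *m Y r) a 0) end.
have fZ b n : f (inl b) n = (-1) ^+ (n * b) * Z b a 0.
  rewrite /f /=; elim: n => [|n IHn]; first by rewrite mul1mx mul1r.
  rewrite exprSr -[_ * _]/(_ *m _) -mulmxA UZ -scalemxAr mxE IHn mulrA.
  by rewrite -exprD mulSn.
have d_inj : injective d.
  have sgn_c b r : (-1) ^+ b != c r.
    by apply: contraTneq (c1 r) => <-; rewrite sqrr_sign ltxx.
  move=> [b1|r1] [b2|r2] /=.
  - by move/signr_inj ->.
  - by move/eqP; rewrite (negPf (sgn_c _ _)).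
  - by move/esym/eqP; rewrite (negPf (sgn_c _ _)).
  - by move/c_inj ->.
have f_rec i : chebyshev_rec (d i) (f i).
  case: i => [b|r] n.
    by rewrite !fZ /=; case: b; rewrite ?muln0 ?muln1 ?exprS /=; ring.
  rewrite /f /= !exprSr -![_ * _]/(_ *m _) -!mulmxA UY.
  by rewrite mulmxBr -scalemxAr !mxE.
have f_bounded i : exists C, forall n, `|f i n| <= C.
  case: i => [b|r]; last exact: chebyshev_rec_bounded (c1 r) (f_rec (inr r)).
  by exists `|Z b a 0| => n; rewrite fZ normrMsign.
have f_sqr i : bounded_discrepancy (fun n => f i n ^+ 2) (l i).
  case: i => [b|r] /=.
    exists 0 => T; rewrite big1 ?normr0 // => n _.
    by rewrite fZ exprMn sqrr_sign mul1r subrr.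
  have := chebyshev_rec_sqr (c1 r) (f_rec (inr r)).
  by rewrite /f /= expr0 expr1 mul1mx.
have [C fC] := choice f_bounded.
have := bounded_discrepancy_sqr_sum d_inj f_rec fC f_sqr.
rewrite big_sumType /=; congr bounded_discrepancy; apply/funext => n.
by rewrite big_sumType /= mulmxDr !mulmx_sumr !mxE !summxE.
Qed.

(** * The walk on arcs *)

Lemma vtx_inj (V : finType) (S : {set V}) : injective (@vtx V S).
Proof.
move=> i j; rewrite /vtx -{2}(splitK i) -{2}(splitK j).
case: (fintype.split i) => a; case: (fintype.split j) => b ab /=.
- by rewrite (enum_val_inj ab).
- by have := enum_valP b; rewrite -ab inE enum_valP.
- by have := enum_valP a; rewrite ab inE enum_valP.
- by rewrite (enum_val_inj ab).
Qed.

Lemma vtx_bij (V : finType) (S : {set V}) : bijective (@vtx V S).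
Proof.
apply: inj_card_bij (@vtx_inj V S) _.
by rewrite card_ord cardsC.
Qed.

Lemma vtx_lshift (V : finType) (S : {set V}) i :
  vtx (lshift #|~: S| i) = enum_val i :> V.
Proof. by rewrite /vtx -[lshift _ _]/(unsplit (inl i)) unsplitK. Qed.

Lemma vtx_rshift (V : finType) (S : {set V}) j :
  vtx (rshift #|S| j) = enum_val j :> V.
Proof. by rewrite /vtx -[rshift _ _]/(unsplit (inr j)) unsplitK. Qed.

Section Walk.
Variables (R : realType) (V : finType) (e : rel V) (k : nat) (S : {set V}).
Hypotheses (simple_e : simple_graph e) (regular_e : regular_graph e k).

Local Notation s := #|S|.
Local Notation t := #|~: S|.
Local Notation A := (adj R e S).
Local Notation H := (adj_H R e S).
Local Notation B := (A_Sbar R e S).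
Local Notation D := (tail_inc R e S).
Local Notation rev := (arc_rev R e).
Local Notation U := (transition R e k S).

Lemma adjT : A^T = A.
Proof. by apply/matrixP => i j; rewrite !mxE simple_e.1. Qed.

Lemma adj_block : A = block_mx (ulsubmx A) H H^T B.
Proof. by rewrite -[LHS]submxK /adj_H trmx_ursub adjT. Qed.

Lemma A_SbarT : B^T = B.
Proof. by rewrite /A_Sbar trmx_drsub adjT. Qed.

Lemma adj_diag i : A i i = 0.
Proof. by rewrite mxE simple_e.2. Qed.

Lemma L_SbarE : L_Sbar R e k S = k%:R%:M - B.
Proof. by apply/matrixP => i j; rewrite !mxE eq_rshift. Qed.

Lemma Q_SbarE : Q_Sbar R e k S = k%:R%:M + B.
Proof. by apply/matrixP => i j; rewrite !mxE eq_rshift. Qed.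

Lemma Q_SE : Q_S R e k S = k%:R%:M + ulsubmx A.
Proof. by apply/matrixP => i j; rewrite !mxE eq_lshift. Qed.

Lemma adj_sum u : \sum_w A u w = k%:R.
Proof.
have [g gK vK] := vtx_bij S.
rewrite -(regular_e (vtx u)) -[in RHS]sum1_card natr_sum [RHS]big_mkcond /=.
rewrite (reindex (@vtx V S)) /=; last by exists g => ? _; [exact: gK|exact: vK].
apply: eq_bigr => w _; rewrite mxE inE; by case: (e _ _).
Qed.

Lemma tail_incT_mulE (p : 'cV[R]_(s + t)) (i : 'I_(s + t))
    (a : 'I_#|arcs e|) :
  vtx i = (arc_of a).1 -> (D^T *m p) a 0 = p i 0.
Proof.
move=> ia; rewrite mxE (bigD1 i) //= big1 => [|j ji].
  by rewrite !mxE ia eqxx mul1r addr0.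
by rewrite !mxE -ia (inj_eq (@vtx_inj V S)) (negPf ji) mul0r.
Qed.

Lemma arc_revE (x : 'cV[R]_#|arcs e|) (a b : 'I_#|arcs e|) :
  arc_of a = ((arc_of b).2, (arc_of b).1) -> (rev *m x) a 0 = x b 0.
Proof.
move=> ab; rewrite mxE (bigD1 b) //= big1 => [|c cb].
  by rewrite !mxE ab eqxx mul1r addr0.
rewrite !mxE ab xpair_eqE; case: andP => [[/eqP e2 /eqP e1]|]; last first.
  by rewrite mul0r.
case/eqP: cb; apply: enum_val_inj; rewrite -/(arc_of c) -/(arc_of b).
by rewrite [arc_of c]surjective_pairing -e1 -e2 -surjective_pairing.
Qed.

Lemma arc_of_revP (a : 'I_#|arcs e|) :
  exists b : 'I_#|arcs e|, arc_of a = ((arc_of b).2, (arc_of b).1).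
Proof.
have aE : ((arc_of a).2, (arc_of a).1) \in arcs e.
  by have := enum_valP a; rewrite !inE /= simple_e.1.
exists (enum_rank_in aE ((arc_of a).2, (arc_of a).1)).
by rewrite [arc_of (enum_rank_in _ _)]enum_rankK_in //=; case: (arc_of a).
Qed.

Lemma arc_rev_invol (x : 'cV[R]_#|arcs e|) : rev *m (rev *m x) = x.
Proof.
apply/colP => a; have [b ab] := arc_of_revP a.
rewrite (arc_revE _ ab) (@arc_revE x b a) //.
by rewrite ab /=; case: (arc_of b).
Qed.

Lemma arc_rev_tail_incE (p : 'cV[R]_(s + t)) (i : 'I_(s + t))
    (a : 'I_#|arcs e|) :
  vtx i = (arc_of a).2 -> (rev *m (D^T *m p)) a 0 = p i 0.
Proof.
move=> ia; have [b ab] := arc_of_revP a.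
by rewrite (arc_revE _ ab) (@tail_incT_mulE _ i) // ia ab.
Qed.

(** [D^T *m p] reads [p] at the tail of an arc and [rev *m (D^T *m p)] at its head, so arcs leaving
    [u] correspond to neighbours of [u]. A general [F] serves both the linear identities for [D] and
    the quadratic means below. *)
Lemma sum_tail (u : 'I_(s + t)) (p : 'cV[R]_(s + t)) (F : R -> R -> R) :
  \sum_(a : 'I_#|arcs e| | (arc_of a).1 == vtx u)
     F ((D^T *m p) a 0) ((rev *m (D^T *m p)) a 0) =
  \sum_w A u w * F (p u 0) (p w 0).
Proof.
have [g gK vK] := vtx_bij S.
pose Phi (x : V * V) := F (p (g x.1) 0) (p (g x.2) 0).
transitivity (\sum_(x in arcs e | x.1 == vtx u) Phi x).
  rewrite big_enum_val_cond /=; apply: eq_bigr => a _.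
  rewrite (@tail_incT_mulE _ (g (arc_of a).1)) ?vK //.
  by rewrite (@arc_rev_tail_incE _ (g (arc_of a).2)) ?vK.
transitivity (\sum_w (if e (vtx u) w then Phi (vtx u, w) else 0)).
  rewrite -big_mkcond /=.
  rewrite (reindex_onto (fun w => (vtx u, w)) snd) /= => [|x /andP[_ /eqP <-]].
    by apply: eq_bigl => w; rewrite inE /= !eqxx !andbT.
  by rewrite -surjective_pairing.
rewrite (reindex (@vtx V S)) /=; last by exists g => ? _; [exact: gK|exact: vK].
apply: eq_bigr => w _; rewrite mxE /Phi /= !gK.
by case: (e _ _); rewrite (mul1r, mul0r).
Qed.

Lemma tail_inc_mulE (x : 'cV[R]_#|arcs e|) u :
  (D *m x) u 0 = \sum_(a : 'I_#|arcs e| | (arc_of a).1 == vtx u) x a 0.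
Proof.
rewrite mxE [RHS]big_mkcond; apply: eq_bigr => a _.
by rewrite mxE eq_sym; case: eqP; rewrite (mul1r, mul0r).
Qed.

Lemma tail_inc_mulT (p : 'cV[R]_(s + t)) : D *m (D^T *m p) = k%:R *: p.
Proof.
apply/colP => u; rewrite tail_inc_mulE (sum_tail u p (fun x _ => x)).
by rewrite -mulr_suml adj_sum mxE.
Qed.

Lemma tail_inc_rev_mulT (p : 'cV[R]_(s + t)) :
  D *m (rev *m (D^T *m p)) = A *m p.
Proof.
by apply/colP => u; rewrite tail_inc_mulE (sum_tail u p (fun _ x => x)) mxE.
Qed.

Lemma O_S_mul n (p : 'M[R]_(s, n)) (q : 'M[R]_(t, n)) :
  O_S R S *m col_mx p q = col_mx 0 q.
Proof. by rewrite mul_block_col !mul0mx mul1mx !add0r. Qed.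

Lemma transition_mulE (x : 'cV[R]_#|arcs e|) :
  U *m x = rev *m (D^T *m ((2 / k%:R) *: (O_S R S *m (D *m x))) - x).
Proof.
by rewrite -mulmxA mulmxBl mul1mx -scalemxAl -scalemxAr !mulmxA.
Qed.

Lemma transition_tail (p : 'cV[R]_(s + t)) : (0 < k)%N ->
  U *m (D^T *m p) = rev *m (D^T *m (2 *: (O_S R S *m p) - p)).
Proof.
move=> k0; rewrite transition_mulE tail_inc_mulT [D^T *m (_ - _)]mulmxBr.
by rewrite -(scalemxAr k%:R) scalerA divfK // pnatr_eq0 -lt0n.
Qed.

Lemma transition_head (p : 'cV[R]_(s + t)) :
  U *m (rev *m (D^T *m p)) =
  rev *m (D^T *m ((2 / k%:R) *: (O_S R S *m (A *m p)))) - D^T *m p.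
Proof.
by rewrite transition_mulE tail_inc_rev_mulT mulmxBr arc_rev_invol.
Qed.

(** Maximum principle: extend an eigenvector by zero to [S]. If [k <= |a|], the vertices where its
    absolute value is maximal are closed under adjacency, hence are all of [V], although the
    extension vanishes on [S]. *)
Lemma eigenvalue_A_Sbar_lt a : connected_graph e -> S != finset.set0 ->
  eigenvalue B a -> a ^+ 2 < k%:R ^+ 2.
Proof.
move=> conn /finset.set0Pn[x0 x0S] /eigenvalueP[v vB v0].
have [g gK vK] := vtx_bij S.
have qB : B *m v^T = a *: v^T by rewrite -{1}A_SbarT -trmx_mul vB linearZ.
pose p : 'cV[R]_(s + t) := col_mx 0 v^T.
have pS x : x \in S -> p (g x) 0 = 0.
  move=> xS; rewrite -(enum_rankK_in xS xS) -(vtx_lshift (S := S)) gK.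
  by rewrite col_mxEu mxE.
have Ap x : x \notin S -> \sum_w A (g x) w * p w 0 = a * p (g x) 0.
  move=> xS; have xC : x \in ~: S by rewrite inE.
  rewrite -(enum_rankK_in xC xC) -(vtx_rshift (S := S)) gK.
  set j := enum_rank_in _ _.
  (* Only one side of this reflexive equation is expanded, which turns the sum in the goal back into
     a matrix product that can be computed by blocks. *)
  have := congr1 (fun m : 'cV_(s + t) => m (rshift s j) 0) (erefl (A *m p)).
  rewrite {1}mxE => ->; rewrite adj_block mul_block_col !col_mxEd.
  by rewrite mulmx0 add0r qB mxE.
have [j vj] : exists j, v 0 j != 0 by apply/rV0Pn.
pose x1 := [arg max_(x > vtx (rshift s j)) `|p (g x) 0|]%O.
have x1max x : `|p (g x) 0| <= `|p (g x1) 0|.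
  by rewrite /x1; case: arg_maxP => // y _; apply.
have x1pos : 0 < `|p (g x1) 0|.
  apply: lt_le_trans (x1max (vtx (rshift s j))).
  by rewrite gK col_mxEd mxE normr_gt0.
rewrite -[a ^+ 2]real_normK ?num_real // ltr_pXn2r ?nnegrE //.
rewrite ltNge; apply/negP => ka.
pose T := [pred x | `|p (g x) 0| == `|p (g x1) 0|].
have Tclosed : fingraph.closed e T.
  apply: intro_closed; first exact: sym_connect_sym simple_e.1.
  move=> x y xy; rewrite !inE => /eqP xM.
  have xS : x \notin S.
    by apply: contraL x1pos => /pS x0'; rewrite -xM x0' normr0 ltxx.
  have term_ge0 w : 0 <= A (g x) w * (`|p (g x1) 0| - `|p w 0|).
    apply: mulr_ge0; first by rewrite mxE ler0n.
    by rewrite subr_ge0 -{1}(gK w) x1max.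
  (* This is where [k <= |a|] enters: [k] times the maximum is at most [|a * p (g x) 0|], which the
     eigenvalue equation and the triangle inequality bound by the sum of [|p|] over the
     neighbours. *)
  have sum_le0 : \sum_w A (g x) w * (`|p (g x1) 0| - `|p w 0|) <= 0.
    under eq_bigr do rewrite mulrBr.
    rewrite sumrB -mulr_suml adj_sum subr_le0.
    apply: (@le_trans _ _ (`|a| * `|p (g x) 0|)).
      by rewrite xM ler_wpM2r.
    rewrite -normrM -Ap //; apply: le_trans (ler_norm_sum _ _ _) _.
    by apply: ler_sum => w _; rewrite normrM ger0_norm // mxE ler0n.
  have /eqP : \sum_w A (g x) w * (`|p (g x1) 0| - `|p w 0|) = 0.
    by apply: le_anti; rewrite sum_le0 sumr_ge0.
  rewrite psumr_eq0 // => /allP/(_ (g y)); rewrite mem_index_enum => /(_ isT).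
  by rewrite mxE !vK xy mul1r subr_eq0 eq_sym.
have := closed_connect Tclosed (conn x1 x0).
by rewrite !inE eqxx pS // normr0 eq_sym (gt_eqF x1pos).
Qed.

(** * Invariant planes and eigenvectors carried by arcs *)

Definition arc_out (p : 'cV[R]_(s + t)) : 'cV[R]_#|arcs e| := D^T *m p.
Definition arc_in (p : 'cV[R]_(s + t)) : 'cV[R]_#|arcs e| :=
  rev *m (D^T *m p).

(** Every mean on an arc will be a quadratic form in the values of [p] at its two ends; summing it
    over the arcs leaving [u] is what produces Schur squares. *)
Lemma adj_quad (u : 'I_(s + t)) (p : 'cV[R]_(s + t)) (d : R) :
  \sum_w A u w * (p u 0 ^+ 2 + p w 0 ^+ 2 - d * p u 0 * p w 0) =
  k%:R * p u 0 ^+ 2 + (A *m schur_sq p) u 0 - d * p u 0 * (A *m p) u 0.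
Proof.
rewrite [(A *m schur_sq p) u 0]mxE [(A *m p) u 0]mxE mulr_sumr.
rewrite -[k%:R](adj_sum u) mulr_suml -big_split -sumrB.
by apply: eq_bigr => w _ /=; rewrite [schur_sq p w 0]mxE; ring.
Qed.

Lemma adj_mul_col n (p : 'M[R]_(s, n)) (q : 'M[R]_(t, n)) :
  A *m col_mx p q = col_mx (ulsubmx A *m p + H *m q) (H^T *m p + B *m q).
Proof. by rewrite {1}adj_block mul_block_col. Qed.

Lemma schur_sq_col n (p : 'M[R]_(s, n)) (q : 'M[R]_(t, n)) :
  schur_sq (col_mx p q) = col_mx (schur_sq p) (schur_sq q).
Proof.
by apply/matrixP => i j; rewrite !mxE; case: fintype.split => ?; rewrite !mxE.
Qed.

Lemma schur_sq0 m n : schur_sq (0 : 'M[R]_(m, n)) = 0.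
Proof. by apply/matrixP => i j; rewrite !mxE mul0r. Qed.

(* The two-dimensional span of [arc_out p] and [arc_in p] is invariant under
   the walk, which acts on it as the rotation of angle [acos (l / k)]. *)
Lemma transition_bulk (q : 'cV[R]_t) (l alpha beta : R) (p := col_mx 0 q) :
  (0 < k)%N -> B *m q = l *: q ->
  U *m (alpha *: arc_out p + beta *: arc_in p) =
  (- beta) *: arc_out p + (alpha + 2 * (l / k%:R) * beta) *: arc_in p.
Proof.
move=> k0 Bq; rewrite mulmxDr -!scalemxAr transition_tail // transition_head.
rewrite adj_mul_col !O_S_mul mulmx0 add0r Bq -/p.
have -> : 2 *: p - p = p by rewrite scaler_nat mulr2n addrK.
have -> : (2 / k%:R) *: col_mx 0 (l *: q) = (2 * (l / k%:R)) *: p.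
  by rewrite /p !scale_col_mx !scaler0 scalerA; congr col_mx; congr *:%R; ring.
rewrite -!scalemxAr -/(arc_in p) -/(arc_out p) scalerBr scalerA scalerDl scaleNr.
by rewrite addrA [LHS]addrC [beta * _]mulrC.
Qed.

(** The images of the two summands contain the same multiple of [rev *m (D^T *m (O_S R S *m p))]
    with opposite signs. Since [O_S] discards the marked rows, [p] has to satisfy the eigenvalue
    equation at unmarked vertices only. *)
Lemma transition_edge (p : 'cV[R]_(s + t)) (b : bool) : (0 < k)%N ->
  O_S R S *m (A *m p) = ((-1) ^+ b * k%:R) *: (O_S R S *m p) ->
  U *m (arc_out p - (-1) ^+ b *: arc_in p) =
  (-1) ^+ b *: (arc_out p - (-1) ^+ b *: arc_in p).
Proof.
move=> k0 Op; rewrite mulmxBr -scalemxAr transition_tail // transition_head Op.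
rewrite scalerA mulrCA divfK ?pnatr_eq0 -?lt0n // [RHS]scalerBr !scalerA.
rewrite -expr2 sqrr_sign scale1r [(-1) ^+ b * 2]mulrC -(scalerA _ ((-1) ^+ b)).
rewrite 2!mulmxBr [(-1) ^+ b *: (_ - _)]scalerBr.
have -> : (-1) ^+ b *: (rev *m (D^T *m (2 *: ((-1) ^+ b *: (O_S R S *m p))))) =
    rev *m (D^T *m (2 *: (O_S R S *m p))).
  by rewrite -!scalemxAr !scalerA mulrCA -expr2 sqrr_sign mulr1.
by rewrite opprB addrC addrA subrK.
Qed.

(** The conserved form is multiplicative: evaluated at the arc entries of [y] and [U *m y], it
    equals [alpha ^+ 2 + beta ^+ 2 + 2 * c * alpha * beta] times the form
    [x ^+ 2 + z ^+ 2 - 2 * c * x * z] in the values [x], [z] of [p] at tail and head. The weight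
    [rho] is this factor times [k]. *)
Lemma bulk_sum (q : 'cV[R]_t) (l alpha beta rho : R) (u : 'I_(s + t))
    (p := col_mx 0 q) (c := l / k%:R) (y := alpha *: arc_out p + beta *: arc_in p) :
  (0 < k)%N -> l ^+ 2 < k%:R ^+ 2 -> B *m q = l *: q ->
  alpha ^+ 2 + beta ^+ 2 + 2 * c * alpha * beta = rho / k%:R ->
  \sum_(a : 'I_#|arcs e| | (arc_of a).1 == vtx u)
     chebyshev_mean c (y a 0) ((U *m y) a 0) =
  (2 * (k%:R ^+ 2 - l ^+ 2))^-1 *
  (rho * (col_mx (k%:R *: H) ((k%:R ^+ 2 - 2 * l ^+ 2)%:M + k%:R *: B)
     *m schur_sq q) u 0).
Proof.
move=> k0 lk Bq rhoE; have kn0 : k%:R != 0 :> R by rewrite pnatr_eq0 -lt0n.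
have kl0 : k%:R ^+ 2 - l ^+ 2 != 0 :> R by rewrite lt0r_neq0 // subr_gt0.
pose F x z := chebyshev_mean c (alpha * x + beta * z)
  (- beta * x + (alpha + 2 * c * beta) * z).
transitivity (\sum_(a : 'I_#|arcs e| | (arc_of a).1 == vtx u)
    F (arc_out p a 0) (arc_in p a 0)).
  by apply: eq_bigr => a _; rewrite /y (transition_bulk _ _ k0 Bq) !mxE.
rewrite sum_tail.
transitivity (rho / k%:R / (2 * (1 - c ^+ 2)) *
    \sum_w A u w * (p u 0 ^+ 2 + p w 0 ^+ 2 - 2 * c * p u 0 * p w 0)).
  rewrite mulr_sumr; apply: eq_bigr => w _; rewrite -rhoE /F /chebyshev_mean.
  ring.
rewrite adj_quad /p schur_sq_col !adj_mul_col schur_sq0 !mulmx0 !add0r Bq.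
have -> : rho / k%:R / (2 * (1 - c ^+ 2)) =
    k%:R * rho * (2 * (k%:R ^+ 2 - l ^+ 2))^-1.
  by rewrite /c; field; rewrite kn0 kl0.
rewrite mul_col_mx mulmxDl mul_scalar_mx -!scalemxAl.
(* At a marked vertex [p] vanishes and only the [H] term remains. At an unmarked one [k] and the
   cross term [- 2 * c * l] combine, after scaling by [k], into [k ^ 2 - 2 l ^ 2]. *)
case: (split_ordP u) => u' ->; rewrite ?col_mxEu ?col_mxEd.
  rewrite [(0 : 'cV_s) u' 0]mxE [(_ *: (H *m _)) u' 0]mxE; ring.
rewrite [(_ *: schur_sq q + _) u' 0]mxE [(_ *: q) u' 0]mxE.
rewrite [(_ *: schur_sq q) u' 0]mxE [schur_sq q u' 0]mxE.
rewrite [(_ *: (B *m _)) u' 0]mxE.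
rewrite /c; field; exact/andP.
Qed.

(** * Contribution of the eigenvalues 1 and -1 *)

(** Common shape of [M_pos1] and [M_neg1], with [W] standing for [H^T] multiplied by the inverse of
    [L_Sbar] or of [Q_Sbar]. *)
Definition edge_mx (W : 'M[R]_(t, s)) : 'M[R]_(s + t) :=
  (4 * k%:R)^-1 *: block_mx
    (Q_S R e k S + H *m schur_sq W - 2 *: schur 1%:M (H *m W)) 0
    (H^T - L_Sbar R e k S *m schur_sq W) 0.

(** For the [W] used below, this extends the indicator of the marked vertex [i] to a solution of
    [A p = (-1) ^ b k p] off [S]; for [b = false] it is the harmonic extension. *)
Definition edge_vec (b : bool) (W : 'M[R]_(t, s)) (i : 'I_s) : 'cV[R]_(s + t) :=
  col_mx (delta_mx i 0) ((-1) ^+ b *: col i W).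

Lemma edge_eigen (b : bool) (W : 'M[R]_(t, s)) (i : 'I_s) :
  (k%:R%:M - (-1) ^+ b *: B) *m W = H^T ->
  (-1) ^+ b *: (B *m col i W) = k%:R *: col i W - col i H^T.
Proof.
move=> WE; rewrite -WE [col i (_ *m _)]colE -mulmxA -colE mulmxBl mul_scalar_mx.
by rewrite -scalemxAl opprB addrC subrK.
Qed.

(* The summand is the squared component of an initial state on the eigenspace
   of the walk for the eigenvalue [(-1) ^+ b]. *)
Lemma edge_sum (b : bool) (W : 'M[R]_(t, s)) (i : 'I_s) (u : 'I_(s + t))
    (kappa : R) (p := edge_vec b W i) :
  kappa ^+ 2 = k%:R^-1 -> (k%:R%:M - (-1) ^+ b *: B) *m W = H^T ->
  \sum_(a : 'I_#|arcs e| | (arc_of a).1 == vtx u)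
     ((kappa / 2) *: (arc_out p - (-1) ^+ b *: arc_in p)) a 0 ^+ 2 =
  edge_mx W u (lshift t i).
Proof.
move=> kappaE WE.
pose F x z := (kappa / 2) ^+ 2 * (x - (-1) ^+ b * z) ^+ 2.
transitivity (\sum_(a : 'I_#|arcs e| | (arc_of a).1 == vtx u)
    F (arc_out p a 0) (arc_in p a 0)).
  by apply: eq_bigr => a _; rewrite /F -exprMn !mxE.
rewrite sum_tail.
transitivity ((4 * k%:R)^-1 *
    \sum_w A u w * (p u 0 ^+ 2 + p w 0 ^+ 2 - 2 * (-1) ^+ b * p u 0 * p w 0)).
  rewrite mulr_sumr; apply: eq_bigr => w _; rewrite /F exprMn kappaE sqrrB.
  rewrite exprMn sqrr_sign invfM; have -> : 2^-1 ^+ 2 = 4^-1 :> R by rewrite exprVn -natrX.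
  by set sg := (-1) ^+ b; ring.
rewrite adj_quad /p /edge_vec schur_sq_col !adj_mul_col /edge_mx [RHS]mxE.
congr (_ * _).
have Wi := edge_eigen i WE.
have sW : schur_sq ((-1) ^+ b *: col i W) = schur_sq (col i W).
  by apply/colP => j; rewrite !mxE mulrACA -expr2 sqrr_sign mul1r.
have sd : schur_sq (delta_mx i 0) = delta_mx i 0 :> 'cV[R]_s.
  by apply/colP => j; rewrite !mxE; case: eqP; rewrite /= (mul1r, mul0r).
have colM n (X : 'M[R]_(n, t)) Y : X *m col i Y = col i (X *m Y).
  by rewrite !colE mulmxA.
have colsq : schur_sq (col i W) = col i (schur_sq W).
  by apply/colP => j; rewrite !mxE.
have A0 : ulsubmx A i i = 0 by rewrite [LHS]mxE [LHS]mxE adj_diag.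
have sgn2 : (-1) ^+ b * (-1) ^+ b = 1 :> R by rewrite -expr2 sqrr_sign.
rewrite sW sd -!scalemxAr -!colE Wi colsq !colM Q_SE L_SbarE mulmxBl.
rewrite mul_scalar_mx; set sg := (-1) ^+ b in sgn2 *.
(* At a marked vertex the cross term survives only for [u' = i], giving the diagonal correction. At
   an unmarked one it equals [2 k W ^ 2] for either sign and turns [k W ^ 2] into [- k W ^ 2], which
   is why [L_Sbar] occurs in both matrices. *)
case: (split_ordP u) => u' ->; rewrite ?col_mxEu ?col_mxEd ?block_mxEul ?block_mxEdl ?row_mxEl.
  move: (ulsubmx A) (H *m _) (H *m _) A0 => A' X Y A0; rewrite !mxE.
  case: eqVneq => [->|_] /=; last by ring.
  rewrite A0; ring: sgn2.
move: (B *m _) => X; rewrite !mxE; ring: sgn2.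
Qed.

Lemma transition_edge_vec (b : bool) (W : 'M[R]_(t, s)) (i : 'I_s) (x : R)
    (z := x *: (arc_out (edge_vec b W i) - (-1) ^+ b *: arc_in (edge_vec b W i))) :
  (0 < k)%N -> (k%:R%:M - (-1) ^+ b *: B) *m W = H^T ->
  U *m z = (-1) ^+ b *: z.
Proof.
move=> k0 /(edge_eigen i) WE; rewrite /z -scalemxAr transition_edge //.
  by rewrite !scalerA mulrC.
rewrite adj_mul_col !O_S_mul scale_col_mx scaler0 scalerA mulrAC -expr2.
by rewrite sqrr_sign mul1r -scalemxAr WE -colE addrC subrK.
Qed.

Lemma transition_bulk_rec (q : 'cV[R]_t) (l alpha beta : R) (p := col_mx 0 q)
    (y := alpha *: arc_out p + beta *: arc_in p) :
  (0 < k)%N -> B *m q = l *: q ->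
  U *m (U *m y) = (2 * (l / k%:R)) *: (U *m y) - y.
Proof.
move=> k0 Bq; rewrite /y !(transition_bulk _ _ k0 Bq).
move: (arc_out _) (arc_in _) => X Y; apply/colP => a; rewrite !mxE; ring.
Qed.

(** This is the right-hand side of [bulk_sum] with [rho = (k ^ 2 - l ^ 2)^-1]; for unmarked columns
    the weight is 1. *)
Lemma M_eigEl (l : R) (G : 'M[R]_t) u i :
  M_eig e k l G u (lshift t i) = (2 * (k%:R ^+ 2 - l ^+ 2))^-1 *
  ((k%:R ^+ 2 - l ^+ 2)^-1 *
   (col_mx (k%:R *: H) ((k%:R ^+ 2 - 2 * l ^+ 2)%:M + k%:R *: B)
     *m schur_sq (col i (G *m H^T))) u 0).
Proof.
rewrite /M_eig mxE mul_mx_row row_mxEl -scalemxAr mxE; congr (_ * (_ * _)).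
rewrite [LHS]mxE [RHS]mxE; apply: eq_bigr => j _; congr (_ * _).
by rewrite [LHS]mxE [RHS]mxE [col _ _ _ _]mxE.
Qed.

Lemma M_eigEr (l : R) (G : 'M[R]_t) u j :
  M_eig e k l G u (rshift s j) = (2 * (k%:R ^+ 2 - l ^+ 2))^-1 *
  (1 * (col_mx (k%:R *: H) ((k%:R ^+ 2 - 2 * l ^+ 2)%:M + k%:R *: B)
     *m schur_sq (col j G)) u 0).
Proof.
rewrite /M_eig mxE mul_mx_row row_mxEr mul1r; congr (_ * _).
rewrite [LHS]mxE [RHS]mxE; apply: eq_bigr => h _; congr (_ * _).
by rewrite [LHS]mxE [RHS]mxE [col _ _ _ _]mxE.
Qed.

(** * Splitting the initial states and summing the means *)

Section Spectrum.
Variables (m : nat) (lambda : 'I_m -> R) (G : 'I_m -> 'M[R]_t).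
Hypotheses (connected_e : connected_graph e) (S_neq0 : S != finset.set0).
Hypothesis lambdaE : distinct_eigenvalues B lambda.
Hypothesis GE : forall r : 'I_m, eigenprojection B (lambda r) (G r).

Lemma lambda_lt r : lambda r ^+ 2 < k%:R ^+ 2.
Proof.
by apply: eigenvalue_A_Sbar_lt => //; apply/lambdaE.2; exists r.
Qed.

Lemma k_sub_lambda_neq0 r (b : bool) : k%:R - (-1) ^+ b * lambda r != 0.
Proof.
apply: contraTneq (lambda_lt r) => /eqP; rewrite subr_eq0 => /eqP ->.
by rewrite exprMn sqrr_sign mul1r ltxx.
Qed.

(** Spectral form of the inverse of [L_Sbar] for [b = false] and of [Q_Sbar] for [b = true]; no
    denominator vanishes because [|lambda r| < k]. *)
Lemma resolvent_mul (b : bool) :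
  (k%:R%:M - (-1) ^+ b *: B) *m
    (\sum_r (k%:R - (-1) ^+ b * lambda r)^-1 *: G r) = 1%:M.
Proof.
rewrite -(eigenprojection_sum1 A_SbarT lambdaE GE) mulmx_sumr.
apply: eq_bigr => r _; rewrite -scalemxAr mulmxBl mul_scalar_mx -scalemxAl.
rewrite (eigenprojection_mull A_SbarT (GE r)) scalerA -scalerBl scalerA.
by rewrite mulVf ?k_sub_lambda_neq0 // scale1r.
Qed.

Definition edge_coef (b : bool) : 'M[R]_(t, s) :=
  \sum_r (k%:R - (-1) ^+ b * lambda r)^-1 *: (G r *m H^T).

Lemma edge_coef_mul (b : bool) : (k%:R%:M - (-1) ^+ b *: B) *m edge_coef b = H^T.
Proof.
rewrite -[RHS]mul1mx -(resolvent_mul b) -mulmxA; congr (_ *m _).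
by rewrite mulmx_suml; apply: eq_bigr => r _; rewrite scalemxAl.
Qed.

Lemma edge_coefE (b : bool) : invmx (k%:R%:M - (-1) ^+ b *: B) *m H^T = edge_coef b.
Proof.
have [Lu _] := mulmx1_unit (resolvent_mul b).
by rewrite -(edge_coef_mul b) mulKmx.
Qed.

Lemma M_pos1E : M_pos1 R e k S = edge_mx (edge_coef false).
Proof.
by rewrite -edge_coefE expr0 scale1r -L_SbarE /M_pos1 -mulmxA.
Qed.

Lemma M_neg1E : M_neg1 R e k S = edge_mx (edge_coef true).
Proof.
by rewrite -edge_coefE expr1 scaleN1r opprK -Q_SbarE /M_neg1 -mulmxA.
Qed.

Lemma edge_mxEr W u j : edge_mx W u (rshift s j) = 0.
Proof.
rewrite mxE; case: (split_ordP u) => u' ->.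
  by rewrite block_mxEur mxE mulr0.
by rewrite block_mxEdr mxE mulr0.
Qed.

(** Shared by marked and unmarked starting vertices: it reduces the limit to a splitting of the
    initial state together with the weights [zeta] and [rho] of its parts. *)
Lemma vertex_prob_orbit (u v : 'I_(s + t)) (Z : bool -> 'cV[R]_#|arcs e|)
    (zeta : bool -> R) (q : 'I_m -> 'cV[R]_t) (alpha beta rho : 'I_m -> R)
    (y := fun r => alpha r *: arc_out (col_mx 0 (q r)) +
                   beta r *: arc_in (col_mx 0 (q r))) :
  (0 < k)%N -> (forall b, U *m Z b = (-1) ^+ b *: Z b) ->
  (forall b,
     \sum_(a : 'I_#|arcs e| | (arc_of a).1 == vtx u) Z b a 0 ^+ 2 = zeta b) ->
  (forall r, B *m q r = lambda r *: q r) ->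
  (forall r, alpha r ^+ 2 + beta r ^+ 2
     + 2 * (lambda r / k%:R) * alpha r * beta r = rho r / k%:R) ->
  init_state R e k v = \sum_b Z b + \sum_r y r ->
  bounded_discrepancy (vertex_prob R e k u v)
    (\sum_b zeta b +
     \sum_r (2 * (k%:R ^+ 2 - lambda r ^+ 2))^-1 *
     (rho r * (col_mx (k%:R *: H)
        ((k%:R ^+ 2 - 2 * lambda r ^+ 2)%:M + k%:R *: B)
        *m schur_sq (q r)) u 0)).
Proof.
move=> k0 UZ zetaE Bq rhoE initE.
have kn0 : k%:R != 0 :> R by rewrite pnatr_eq0 -lt0n.
under [X in _ + X]eq_bigr do rewrite -(bulk_sum _ k0 (lambda_lt _) (Bq _) (rhoE _)).
under [X in X + _]eq_bigr do rewrite -zetaE.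
rewrite exchange_big [X in _ + X]exchange_big -big_split /=.
have -> : vertex_prob R e k u v = fun n =>
    \sum_(a : 'I_#|arcs e| | (arc_of a).1 == vtx u)
      ((U ^+ n *m init_state R e k v) a 0) ^+ 2.
  apply/funext => n; apply: eq_bigr => a _.
  by rewrite real_normK // num_real.
apply: bounded_discrepancy_sum => a.
apply: (matrix_orbit_discrepancy _ _ _ UZ _ initE) => [r1 r2|r|r].
- by move/(mulIf (invr_neq0 kn0))/lambdaE.1.
- by rewrite expr_div_n ltr_pdivrMr ?mul1r ?lambda_lt // exprn_gt0 // ltr0n.
- exact: transition_bulk_rec.
Qed.

(** Resolution of the identity on the unmarked vertices. No eigenvector for 1 or -1 occurs, whence
    the zero right-hand columns of [M_pos1] and [M_neg1]. *)
Lemma init_state_rshift j (kappa := (Num.sqrt k%:R)^-1) :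
  init_state R e k (rshift s j) =
  \sum_(b : bool) 0 + \sum_r (kappa *: arc_out (col_mx 0 (col j (G r))) +
     0 *: arc_in (col_mx 0 (col j (G r)))).
Proof.
rewrite big1 // add0r; under eq_bigr do rewrite scale0r addr0.
rewrite -scaler_sumr -mulmx_sumr; congr (_ *: (_ *m _)).
have -> : \sum_r col_mx 0 (col j (G r)) = col_mx (0 : 'cV[R]_s) (\sum_r col j (G r)).
  apply/colP => x; rewrite summxE; case: (split_ordP x) => x' ->.
    by rewrite col_mxEu mxE big1 // => r _; rewrite col_mxEu mxE.
  by rewrite col_mxEd summxE; apply: eq_bigr => r _; rewrite col_mxEd.
have -> : \sum_r col j (G r) = delta_mx j 0.
  rewrite -[RHS]mul1mx -colE -(eigenprojection_sum1 A_SbarT lambdaE GE).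
  apply/colP => x; rewrite [RHS]mxE !summxE.
  by apply: eq_bigr => r _; rewrite mxE.
apply/colP => x; case: (split_ordP x) => x' ->.
  by rewrite col_mxEu !mxE eq_lrshift.
by rewrite col_mxEd !mxE eq_rshift.
Qed.

(** Partial fractions: half the difference and half the sum of [(k - lambda r)^-1] and
    [(k + lambda r)^-1] are [lambda r * mu r] and [k * mu r]. The first corrects the [arc_out] part
    to the indicator of vertex [i] ([e1]), the second cancels the [arc_in] part ([e2]). *)
Lemma init_state_lshift i (kappa := (Num.sqrt k%:R)^-1)
    (mu := fun r => (k%:R ^+ 2 - lambda r ^+ 2)^-1)
    (p := fun b => edge_vec b (edge_coef b) i)
    (q := fun r => col_mx 0 (col i (G r *m H^T))) :
  init_state R e k (lshift t i) =
  \sum_b (kappa / 2) *: (arc_out (p b) - (-1) ^+ b *: arc_in (p b)) +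
  \sum_r ((kappa * - (lambda r * mu r)) *: arc_out (q r) +
          (kappa * (k%:R * mu r)) *: arc_in (q r)).
Proof.
have coefE b x : col i (edge_coef b) x 0 =
    \sum_r (k%:R - (-1) ^+ b * lambda r)^-1 * col i (G r *m H^T) x 0.
  rewrite [LHS]mxE summxE; apply: eq_bigr => r _.
  by rewrite mxE; congr (_ * _); rewrite [RHS]mxE.
have nz r : [/\ k%:R - lambda r != 0, k%:R + lambda r != 0
    & k%:R ^+ 2 - lambda r ^+ 2 != 0].
  have := k_sub_lambda_neq0 r false; have := k_sub_lambda_neq0 r true.
  by rewrite expr0 expr1 mul1r mulN1r opprK subr_sqr mulf_eq0 => /negPf-> /negPf->.
have e1 : delta_mx (lshift t i) 0 = 2^-1 *: p false + 2^-1 *: p true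
    + \sum_r (- (lambda r * mu r)) *: q r.
  apply/colP => x; rewrite [RHS]mxE [in RHS]mxE summxE.
  rewrite [(_ *: p false) x 0]mxE [(_ *: p true) x 0]mxE.
  case: (split_ordP x) => x' ->.
    rewrite !col_mxEu [in LHS]mxE eq_lshift big1 => [|r _].
      by rewrite addr0 -mulrDl; rewrite [in RHS]mxE; field.
    by rewrite mxE col_mxEu mxE mulr0.
  rewrite !col_mxEd [in LHS]mxE eq_rlshift [(_ *: col i _) x' 0]mxE.
  rewrite [((-1) ^+ true *: col i _) x' 0]mxE !coefE !mulr_sumr -!big_split /=.
  rewrite big1 // => r _; rewrite [(_ *: q r) _ _]mxE col_mxEd /mu.
  have [n1 n2 n3] := nz r; rewrite expr0 expr1 !mul1r !mulN1r opprK.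
  by field; rewrite n1 n2 n3.
have e2 : 0 = (- 2^-1) *: p false + 2^-1 *: p true
    + \sum_r (k%:R * mu r) *: q r.
  apply/colP => x; rewrite [RHS]mxE [in RHS]mxE summxE.
  rewrite [(_ *: p false) x 0]mxE [(_ *: p true) x 0]mxE.
  case: (split_ordP x) => x' ->.
    rewrite !col_mxEu [in LHS]mxE big1 => [|r _]; last first.
      by rewrite mxE col_mxEu mxE mulr0.
    by rewrite addr0 mulNr addNr.
  rewrite !col_mxEd [in LHS]mxE [(_ *: col i _) x' 0]mxE.
  rewrite [((-1) ^+ true *: col i _) x' 0]mxE !coefE !mulr_sumr -!big_split /=.
  rewrite big1 // => r _; rewrite [(_ *: q r) _ _]mxE col_mxEd /mu.
  have [n1 n2 n3] := nz r; rewrite expr0 expr1 !mul1r !mulN1r opprK.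
  by field; rewrite n1 n2 n3.
have lin n (M : 'M[R]_(n, s + t)) a b x y (d : 'I_m -> R) (z : 'I_m -> 'cV_(s + t)) :
    M *m (a *: x + b *: y + \sum_r d r *: z r) =
    a *: (M *m x) + b *: (M *m y) + \sum_r d r *: (M *m z r).
  rewrite !mulmxDr -!scalemxAr mulmx_sumr; congr (_ + _).
  by apply: eq_bigr => r _; rewrite -scalemxAr.
have {}e1 := congr1 (mulmx D^T) e1; rewrite lin in e1.
have {}e2 := congr1 (mulmx (rev *m D^T)) e2; rewrite lin mulmx0 in e2.
have arc_inE : arc_in = mulmx (rev *m D^T).
  by apply/funext => x; rewrite /arc_in mulmxA.
(* The added zero is expanded by [e2] into the [arc_in] terms. *)
transitivity (kappa *: (D^T *m delta_mx (lshift t i) 0) +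
    kappa *: (0 : 'cV[R]_#|arcs e|)); first by rewrite scaler0 addr0.
rewrite e1 [X in _ + kappa *: X]e2 big_bool big_split /=.
under [X in _ = _ + (X + _)]eq_bigr do rewrite -scalerA.
under [X in _ = _ + (_ + X)]eq_bigr do rewrite -scalerA.
rewrite -!scaler_sumr arc_inE /arc_out expr0 expr1.
move: (\sum_r _) (\sum_r _) (D^T *m p _) (D^T *m p _).
move: (_ *m p _) (_ *m p _).
move=> X1 X2 X3 X4 X5 X6; apply/colP => a; rewrite !mxE; ring.
Qed.

Lemma vertex_prob_discrepancy (u v : 'I_(s + t)) :
  bounded_discrepancy (vertex_prob R e k u v)
   ((M_pos1 R e k S + M_neg1 R e k S + \sum_r M_eig e k (lambda r) (G r)) u v).
Proof.
(* For [k = 0] there are no arcs and, as [lambda r ^+ 2 < 0] is impossible, no eigenvalues; [M_pos1]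
   and [M_neg1] vanish because the inverse of 0 is 0. *)
have [k0|k0] := posnP k.
  have m0 (r : 'I_m) : False.
    by have := lambda_lt r; rewrite k0 expr0n /= ltNge sqr_ge0.
  have no_arc (a : 'I_#|arcs e|) : False.
    have := enum_valP a; rewrite inE => ea.
    have := regular_e (arc_of a).1; rewrite [RHS]k0 => /eqP.
    by rewrite cards_eq0 => /eqP/setP/(_ (arc_of a).2); rewrite !inE ea.
  rewrite big1 => [|r]; last by case: (m0 r).
  have -> : M_pos1 R e k S = 0 by rewrite /M_pos1 k0 mulr0 invr0 scale0r.
  have -> : M_neg1 R e k S = 0 by rewrite /M_neg1 k0 mulr0 invr0 scale0r.
  rewrite !addr0 mxE.
  exists 0 => T; rewrite big1 ?normr0 // => n _.
  by rewrite /vertex_prob big1 ?subrr // => a; case: (no_arc a).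
have kappa2 : (Num.sqrt k%:R)^-1 ^+ 2 = k%:R^-1 :> R.
  by rewrite exprVn sqr_sqrtr.
have kn0 : k%:R != 0 :> R by rewrite pnatr_eq0 -lt0n.
rewrite M_pos1E M_neg1E mxE [(edge_mx _ + _) u v]mxE summxE.
case: (split_ordP v) => [i|j] ->.
  rewrite [edge_mx _ u _ + edge_mx _ u _]addrC.
  under eq_bigr do rewrite M_eigEl.
  have -> : edge_mx (edge_coef true) u (lshift t i) +
      edge_mx (edge_coef false) u (lshift t i) =
      \sum_(b : bool) edge_mx (edge_coef b) u (lshift t i) by rewrite big_bool.
  apply: (vertex_prob_orbit k0 _ _ _ _ (init_state_lshift i)) => [b|b|r|r].
  - exact: transition_edge_vec (edge_coef_mul b).
  - exact: edge_sum kappa2 (edge_coef_mul b).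
  - rewrite [col i _]colE mulmxA mulmxA (eigenprojection_mull A_SbarT (GE r)).
    by rewrite -!scalemxAl -mulmxA.
  have kl : k%:R ^+ 2 - lambda r ^+ 2 != 0.
    by rewrite lt0r_neq0 // subr_gt0 lambda_lt.
  rewrite -[in RHS]kappa2; set kappa := (Num.sqrt _)^-1.
  (* The cross term contributes [- 2 lambda ^ 2], so the numerator is [k ^ 2 - lambda ^ 2] over its
     square; this gives the weight [rho] of a marked start. *)
  suff : (lambda r / (k%:R ^+ 2 - lambda r ^+ 2)) ^+ 2 +
      (k%:R / (k%:R ^+ 2 - lambda r ^+ 2)) ^+ 2 -
      2 * (lambda r / k%:R) * (lambda r / (k%:R ^+ 2 - lambda r ^+ 2)) *
      (k%:R / (k%:R ^+ 2 - lambda r ^+ 2)) = (k%:R ^+ 2 - lambda r ^+ 2)^-1.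
    by move=> muE; rewrite -[in RHS]muE; ring.
  by field; rewrite kn0 kl.
under eq_bigr do rewrite M_eigEr.
rewrite !edge_mxEr !add0r.
have sum0 : \sum_(b : bool) 0 = 0 :> R by rewrite big1.
have := @vertex_prob_orbit u _ (fun=> 0) (fun=> 0) _ _ _ (fun=> 1) k0
  _ _ _ _ (init_state_rshift j).
rewrite sum0 add0r; apply => [b|b|r|r].
- by rewrite mulmx0 scaler0.
- by rewrite big1 // => a _; rewrite [X in X ^+ 2]mxE expr2 mulr0.
- by rewrite [col j _]colE mulmxA (eigenprojection_mull A_SbarT (GE r)) -scalemxAl.
by rewrite kappa2 mulr0 expr0n !addr0 mul1r.
Qed.

End Spectrum.

End Walk.

Theorem theorem4p1 (R : realType) (V : finType) (e : rel V) (k : nat)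
    (S : {set V}) (m : nat) (lambda : 'I_m -> R) (G : 'I_m -> 'M[R]_#|~: S|)
    (simple_e : simple_graph e) (regular_e : regular_graph e k)
    (connected_e : connected_graph e) (S_neq0 : S != finset.set0)
    (lambdaE : distinct_eigenvalues (A_Sbar R e S) lambda)
    (GE : forall r : 'I_m, eigenprojection (A_Sbar R e S) (lambda r) (G r)) :
  (forall u v : 'I_(#|S| + #|~: S|),
     cvg (time_avg R e k u v T @[T --> \oo])) /\
  avg_mixing R e k S =
    M_pos1 R e k S + M_neg1 R e k S + \sum_(r < m) M_eig e k (lambda r) (G r).
Proof.
have disc := vertex_prob_discrepancy simple_e regular_e connected_e S_neq0
  lambdaE GE.
split=> [u v|].
  by apply/cvg_ex; eexists; exact: bounded_discrepancy_cvg (disc u v).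
apply/matrixP => u v; rewrite mxE; apply: cvg_lim => //.
exact: bounded_discrepancy_cvg (disc u v).
Qed.
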